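(* Let $A\in\mathrm{ASM}(n)$ and $i\in[n-1]$. The following are equivalent: (1) Each row of $m_{A^T}$ that contains $i+1$ also contains $i$. (2) $\pi_i(A)=A$, i.e., $A$ does not have a descent in row $i$. (3) $A$ does not have an essential cell in row $i$. (4) $m_A$ does not have an essential point in row $i$. (5) There exists $C\in\mathrm{ASM}(n)$ such that $C\ne A$ and $\pi_i(C)=A$. (6) The bumpless pipe dream $\Phi(A)$ has no liftable column crossing for $i$.
   Context: $[n]=\{1,\dots,n\}$. An $n\times n$ alternating sign matrix (ASM) is a matrix $A=(A_{i,j})$ with entries in $\{-1,0,1\}$ such that $\sum_{j=1}^m A_{i,j}\in\{0,1\}$ for all $i,m\in[n]$, $\sum_{i=1}^m A_{i,j}\in\{0,1\}$ for all $j,m\in[n]$, and the sum of all entries is $n$; $\mathrm{ASM}(n)$ is the set of these. The corner sum function of $A$ is $\mathrm{rk}_A(i,j)=\sum_{a\in[i],\,b\in[j]}A_{a,b}$. Strong order on $\mathrm{ASM}(n)$: $A\le B$ iff $\mathrm{rk}_A(i,j)\ge \mathrm{rk}_B(i,j)$ for all $i,j\in[n]$. For $i\in[n-1]$, $\pi_i(A)$ is the minimum, in strong order, of $\{B\in\mathrm{ASM}(n): \mathrm{rk}_B(a,b)=\mathrm{rk}_A(a,b)\text{ for all }a,b\in[n]\text{ with }a\ne i\}$ (this minimum is known to exist). $i\in[n-1]$ is a descent of $A$ if $\pi_i(A)<A$ (equivalently $\pi_i(A)\neq A$). Inversions and essential cells: $(i,j)\in[n]\times[n]$ is an inversion of $A$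 if $\sum_{k=1}^jA_{i,k}=\sum_{l=1}^iA_{l,j}=0$; $\mathrm{inv}(A)$ is the set of inversions. The set of essential cells of $A$ is $\mathrm{ess}(A)=\{(i,j)\in\mathrm{inv}(A):(i+1,j)\notin\mathrm{inv}(A),\ (i,j+1)\notin\mathrm{inv}(A)\}$; $(i,j)$ is a cell in row $i$. Monotone triangles: a monotone triangle of size $n$ is an array $m=(m(i,j))_{1\le j\le i\le n}$ with entries in $[n]$ such that $m(i,j)<m(i,j+1)$, $m(i,j)\le m(i-1,j)$ and $m(i,j)\le m(i+1,j+1)$ whenever both sides are defined. For $A\in\mathrm{ASM}(n)$, let $\widetilde A$ be the matrix whose $i$th row is the sum of the first $i$ rows of $A$ (a $0/1$ matrix with exactly $i$ ones in row $i$); $m_A$ is the monotone triangle whose $i$th row $m_A(i,1)<\dots<m_A(i,i)$ lists the column indices of the ones in row $i$ of $\widetilde A$. For $1\le b\le a\le n$, $(a,b)$ is an essential point of a monotone triangle $m$ (lying in row $a$) if the array obtained from $m$ by replacing $m(a,b)$ with $m(a,b)-1$, all other entries unchanged, is again a monotone triangle of size $n$. Bumpless pipe dreams: in an $n\times n$ grid with matrix coordinates, fill each cell with one of six tiles, each determined by which of the midpoints of its edges Left, Right, Top, Bottom are met by pipe segments: blank (none), horizontal (L,R), vertical (T,B), cross (L,R,T,B; a horizontal and a vertical segment crossing), the ''r-tile'' (an elbow joining B and R), and the ''j-tile'' (an elbow joining L and T). A bumpless pipe dream (BPD) is such a tiling forming a network of exactly $n$ pipes, each starting at the bottom edge of the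 grid and exiting at the right edge. There is a bijection from BPDs to $\mathrm{ASM}(n)$ sending a BPD to the matrix with entry $1$ at the r-tiles, $-1$ at the j-tiles, and $0$ elsewhere; $\Phi(A)$ denotes the BPD corresponding to $A$. A liftable column crossing for $i$ in a BPD is a pipe in row $i+1$ crossing from some column $j$ to column $j+1$ such that no pipe in row $i$ crosses from column $j$ to column $j+1$. *)

(* Defs.v *)
From HB Require Import structures.
From mathcomp Require Import all_boot all_order all_algebra.
From mathcomp Require Import zify.

Set Implicit Arguments.
Unset Strict Implicit.
Unset Printing Implicit Defensive.

Import Order.TTheory GRing.Theory Num.Theory.
Local Open Scope ring_scope.

(* Rows and columns are numbered from 0: the ordinal [i : 'I_n] stands for
   the element i + 1 of [n] = {1, ..., n}.                                  *)

(** Alternating sign matrices *)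

Definition row_psum (n : nat) (A : 'M[int]_n) (i m : 'I_n) : int :=
  \sum_(j < n | (j <= m)%N) A i j.

Definition col_psum (n : nat) (A : 'M[int]_n) (m j : 'I_n) : int :=
  \sum_(i < n | (i <= m)%N) A i j.

Definition is_asm (n : nat) (A : 'M[int]_n) : bool :=
  [&& [forall i, forall j, A i j \in [:: -1; 0; 1]],
      [forall i, forall m, row_psum A i m \in [:: 0; 1]],
      [forall m, forall j, col_psum A m j \in [:: 0; 1]]
    & \sum_i \sum_j A i j == n%:Z].

Record asm (n : nat) := ASM { asm_mx :> 'M[int]_n; asmP : is_asm asm_mx }.

HB.instance Definition _ n := [isSub for @asm_mx n].
HB.instance Definition _ n := [Equality of asm n by <:].

Definition corner_sum (n : nat) (A : 'M[int]_n) (i j : 'I_n) : int :=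
  \sum_(a < n | (a <= i)%N) \sum_(b < n | (b <= j)%N) A a b.

Definition strong_le (n : nat) (A B : asm n) : Prop :=
  forall i j : 'I_n, corner_sum B i j <= corner_sum A i j.

Definition strong_lt (n : nat) (A B : asm n) : Prop :=
  strong_le A B /\ A <> B.

Definition agree_off_row (n : nat) (i : 'I_n) (A B : asm n) : Prop :=
  forall a b : 'I_n, a != i -> corner_sum B a b = corner_sum A a b.

Definition is_pi (n : nat) (i : 'I_n) (A B : asm n) : Prop :=
  agree_off_row i A B /\ forall C : asm n, agree_off_row i A C -> strong_le B C.

Section PartialSums.
Variable n : nat.
Implicit Types (A : 'M[int]_n) (f : 'I_n -> int).

Definition psum f (a : nat) : int := \sum_(x < n | (x < a)%N) f x.
Definition csum A (a b : nat) : int := psum (fun x => psum (A x) b) a.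

Lemma psum0 f : psum f 0 = 0.
Proof. by rewrite /psum big_pred0. Qed.

Lemma psumS f (a : 'I_n) : psum f a.+1 = psum f a + f a.
Proof.
rewrite /psum (bigD1 a) //= addrC; congr (_ + _).
by apply: eq_bigl => x; rewrite -val_eqE /=; lia.
Qed.

Lemma psum_ge f a : (n <= a)%N -> psum f a = \sum_x f x.
Proof.
by move=> na; apply: eq_bigl => x; rewrite (leq_trans (ltn_ord x) na).
Qed.

Lemma csumC A a b : csum A a b = psum (fun y => psum (A^~ y) a) b.
Proof. by rewrite /csum /psum exchange_big. Qed.

Lemma psum01 f : (forall m : 'I_n, psum f m.+1 \in [:: 0; 1 : int]) ->
  forall a, 0 <= psum f a <= 1.
Proof.
move=> H; have H' a : (a <= n)%N -> 0 <= psum f a <= 1.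
  case: a => [|a] an; first by rewrite psum0.
  by have := H (Ordinal an); rewrite !inE => /orP[] /eqP ->.
move=> a; case: (leqP a n) => [/H'//|/ltnW na].
by rewrite psum_ge // -(psum_ge f (leqnn n)) H'.
Qed.

Lemma psum_range f : (forall x, 0 <= f x <= 1) ->
  forall a, 0 <= psum f a.+1 - psum f a <= 1.
Proof.
move=> H a; case: (ltnP a n) => an.
  by rewrite (psumS f (Ordinal an)) /= addrAC subrr add0r.
by rewrite !psum_ge // ?subrr // ltnW.
Qed.

Section OfAsm.
Variable A : asm n.

Lemma asm_entry i j : (A i j == -1) || (A i j == 0) || (A i j == 1).
Proof.
by case/and4P: (asmP A) => /forallP/(_ i)/forallP/(_ j); rewrite !inE orbA.
Qed.

Lemma asm_row01 i b : 0 <= psum (A i) b <= 1.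
Proof.
by apply: psum01 => m; case/and4P: (asmP A) => _ /forallP/(_ i)/forallP/(_ m).
Qed.

Lemma asm_col01 j a : 0 <= psum (A^~ j) a <= 1.
Proof.
apply: psum01 => m.
by case/and4P: (asmP A) => _ _ /forallP/(_ m)/forallP/(_ j).
Qed.

Lemma asm_stepV a b : 0 <= csum A a.+1 b - csum A a b <= 1.
Proof. by apply: psum_range => x; apply: asm_row01. Qed.

Lemma asm_stepH a b : 0 <= csum A a b.+1 - csum A a b <= 1.
Proof. by rewrite !csumC; apply: psum_range => x; apply: asm_col01. Qed.

Lemma csum0l b : csum A 0 b = 0. Proof. exact: psum0. Qed.
Lemma csum0r a : csum A a 0 = 0. Proof. by rewrite csumC psum0. Qed.

Lemma csum_nn a b : (n <= a)%N -> (n <= b)%N -> csum A a b = n%:Z.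
Proof.
move=> na nb; rewrite /csum psum_ge //.
case/and4P: (asmP A) => _ _ _ /eqP <-.
by apply: eq_bigr => x _; rewrite psum_ge.
Qed.

Lemma csum_n a b : (n <= a)%N -> (b <= n)%N -> csum A a b = b%:Z.
Proof.
move=> na bn.
have H k : 0 <= csum A a k <= k%:Z.
  elim: k => [|k IH]; first by rewrite csum0r.
  by have := asm_stepH a k; lia.
have K k : csum A a (b + k) <= csum A a b + k%:Z.
  elim: k => [|k IH]; first by rewrite addn0 addr0.
  by rewrite addnS; have := asm_stepH a (b + k); lia.
have := K (n - b)%N; rewrite subnKC // csum_nn //.
by have := H b; lia.
Qed.

Lemma csum_geV a b : (n <= a)%N -> csum A a b = csum A n b.
Proof. by move=> na; rewrite /csum !psum_ge. Qed.

End OfAsm.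

Section OfHeight.
Variable G : nat -> nat -> int.
Hypothesis G0l : forall b, G 0 b = 0.
Hypothesis G0r : forall a, G a 0 = 0.
Hypothesis GV : forall a b, 0 <= G a.+1 b - G a b <= 1.
Hypothesis GH : forall a b, 0 <= G a b.+1 - G a b <= 1.
Hypothesis Gn : G n n = n%:Z.

Let M : 'M[int]_n :=
  \matrix_(x, y) (G x.+1 y.+1 - G x.+1 y - (G x y.+1 - G x y)).

Let rowM (x : 'I_n) b : (b <= n)%N -> psum (M x) b = G x.+1 b - G x b.
Proof.
elim: b => [|b IH] bn; first by rewrite psum0 !G0r.
by rewrite (psumS _ (Ordinal bn)) IH ?(ltnW bn) // mxE /=; lia.
Qed.

Let colM (y : 'I_n) a : (a <= n)%N -> psum (M^~ y) a = G a y.+1 - G a y.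
Proof.
elim: a => [|a IH] an; first by rewrite psum0 !G0l.
by rewrite (psumS _ (Ordinal an)) IH ?(ltnW an) // mxE /=; lia.
Qed.

Let csumM a b : (a <= n)%N -> (b <= n)%N -> csum M a b = G a b.
Proof.
move=> an bn; elim: a an => [|a IH] an; first by rewrite /csum psum0 G0l.
rewrite /csum (psumS _ (Ordinal an)) -/(csum M a b) IH ?(ltnW an) //.
by rewrite rowM //=; lia.
Qed.

Lemma height_is_asm : is_asm M.
Proof.
apply/and4P; split.
- apply/forallP=> x; apply/forallP=> y; rewrite mxE !inE.
  by have := GV x y; have := GV x y.+1; lia.
- apply/forallP=> x; apply/forallP=> y.
  by rewrite !inE [row_psum _ _ _](rowM x (ltn_ord y)); have := GV x y.+1; lia.
- apply/forallP=> x; apply/forallP=> y.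
  by rewrite !inE [col_psum _ _ _](colM y (ltn_ord x)); have := GH x.+1 y; lia.
rewrite -Gn -(csumM (leqnn n) (leqnn n)) /csum psum_ge //; apply/eqP.
by apply: eq_bigr => x _; rewrite psum_ge.
Qed.

Lemma asm_of_height :
  {B : asm n | forall a b, (a <= n)%N -> (b <= n)%N -> csum B a b = G a b}.
Proof. by exists (ASM height_is_asm). Qed.

End OfHeight.

(* Row i of the corner sums of pi_i(A) is as large as its neighbours allow. *)
Definition pi_height (A : asm n) (i a b : nat) : int :=
  if a == i.+1 then Num.min (csum A i b + 1) (csum A i.+2 b) else csum A a b.

Lemma pi_exists (i : 'I_n) (A : asm n) : {B : asm n | is_pi i A B}.
Proof.
pose G a b := if b is 0%N then 0 else pi_height A i a b.
have G0l b : G 0%N b = 0 by case: b => [|b] //; rewrite /G /pi_height /= csum0l.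
have GV a b : 0 <= G a.+1 b - G a b <= 1.
  case: b => [|b] //; rewrite /G /pi_height eqSS.
  have := asm_stepV A a b.+1; have := asm_stepV A i b.+1.
  have := asm_stepV A i.+1 b.+1.
  case: (a =P i :> nat) => [->|_]; first by rewrite ltn_eqF //; lia.
  by case: (a =P i.+1) => [->|_]; lia.
have GH a b : 0 <= G a b.+1 - G a b <= 1.
  have H c : 0 <= csum A c 1 <= 1.
    by have := asm_stepH A c 0; rewrite csum0r subr0.
  case: b => [|b]; rewrite /G /pi_height.
    by have := H a; have := H i; have := H i.+2; case: ifP; lia.
  have := asm_stepH A a b.+1; have := asm_stepH A i b.+1.
  by have := asm_stepH A i.+2 b.+1; case: ifP; lia.
have Gn : G n n = n%:Z.
  have n0 : (0 < n)%N by apply: leq_ltn_trans (ltn_ord i).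
  have -> : G n n = pi_height A i n n by rewrite -[X in G _ X](prednK n0) /G (prednK n0).
  rewrite /pi_height; case: eqP => [E|_]; last exact: csum_nn.
  have := asm_stepV A i n; rewrite -E (csum_nn A (leqnn n)) //.
  by rewrite (csum_nn A (leqnSn n)) //; lia.
have [B HB] := asm_of_height G0l (fun=> erefl) GV GH Gn.
exists B; split=> [a b ai|C HC x y].
  rewrite [LHS](HB a.+1 b.+1) //= /pi_height eqSS.
  by rewrite ifN.
have HC' a b : (a <= n)%N -> (b <= n)%N -> a != i.+1 -> csum C a b = csum A a b.
  case: a b => [|a] [|b] an bn; rewrite ?csum0l ?csum0r //.
  by rewrite eqSS => ai; apply: (HC (Ordinal an) (Ordinal bn)).
have HC2 : csum C i.+2 y.+1 = csum A i.+2 y.+1.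
  case: (ltnP i.+1 n) => hi; first by apply: HC' => //; lia.
  by rewrite !csum_n // ltnW.
rewrite [X in _ <= X](HB x.+1 y.+1) //= /pi_height.
rewrite -[corner_sum _ _ _]/(csum C x.+1 y.+1); case: eqP => [[xi]|/eqP xi].
  rewrite xi; have := asm_stepV C i y.+1; have := asm_stepV C i.+1 y.+1.
  by rewrite HC2 (HC' i) ?(ltnW (ltn_ord i)) //; lia.
by rewrite HC'.
Qed.

End PartialSums.

Definition asm_pi (n : nat) (i : 'I_n) (A : asm n) : asm n := sval (pi_exists i A).

Definition descent (n : nat) (i : 'I_n) (A : asm n) : Prop :=
  strong_lt (asm_pi i A) A.

(** Inversions and essential cells *)

Definition inversion (n : nat) (A : 'M[int]_n) (i j : 'I_n) : bool :=
  (row_psum A i j == 0) && (col_psum A i j == 0).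

(* A position outside the grid is not an inversion. *)
Definition essential_cell (n : nat) (A : 'M[int]_n) (i j : 'I_n) : bool :=
  [&& inversion A i j,
      [forall i' : 'I_n, (i' == i.+1 :> nat) ==> ~~ inversion A i' j]
    & [forall j' : 'I_n, (j' == j.+1 :> nat) ==> ~~ inversion A i j']].

(** Monotone triangles *)

Definition triangle (n : nat) : Type := forall i : 'I_n, 'I_i.+1 -> 'I_n.

Definition is_monotone (n : nat) (m : triangle n) : Prop :=
  [/\ forall (i : 'I_n) (j j' : 'I_i.+1), j' = j.+1 :> nat -> (m i j < m i j')%N,
      forall (i i' : 'I_n) (j : 'I_i.+1) (j' : 'I_i'.+1),
        i = i'.+1 :> nat -> j' = j :> nat -> (m i j <= m i' j')%N
    & forall (i i' : 'I_n) (j : 'I_i.+1) (j' : 'I_i'.+1),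
        i' = i.+1 :> nat -> j' = j.+1 :> nat -> (m i j <= m i' j')%N].

(* [m'] is [m] with the entry [m a b] replaced by [m a b - 1]; in particular
   the entry to be replaced is not the least element of [n]. *)
Definition essential_point (n : nat) (m : triangle n) (a : 'I_n) (b : 'I_a.+1)
    : Prop :=
  exists m' : triangle n,
    [/\ (m' a b).+1 = m a b :> nat,
        forall (i : 'I_n) (j : 'I_i.+1),
          ((i : nat), (j : nat)) != ((a : nat), (b : nat)) -> m' i j = m i j
      & is_monotone m'].

Definition row_sums (n : nat) (A : 'M[int]_n) : 'M[int]_n :=
  \matrix_(i < n) \sum_(k < n | (k <= i)%N) row k A.

(* For an alternating sign matrix the list below is increasing and has exactly
   i + 1 elements, so that the default value of [nth] is never used. *)
Definition triangle_of (n : nat) (A : 'M[int]_n) : triangle n :=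
  fun i j => nth i [seq k <- enum 'I_n | row_sums A i k == 1] j.

Definition row_contains (n : nat) (m : triangle n) (i k : 'I_n) : Prop :=
  exists j : 'I_i.+1, m i j = k.

(** Bumpless pipe dreams *)

Inductive tile := Blank | Horizontal | Vertical | Crossing | RTile | JTile.
Inductive side := Left | Right | Top | Bottom.

(* Segments are directed the way they are traversed by a pipe which comes from
   the bottom edge of the grid: such a pipe only moves up and right. *)
Definition tile_segments (t : tile) : seq (side * side) :=
  match t with
  | Blank => [::]
  | Horizontal => [:: (Left, Right)]
  | Vertical => [:: (Bottom, Top)]
  | Crossing => [:: (Left, Right); (Bottom, Top)]
  | RTile => [:: (Bottom, Right)]
  | JTile => [:: (Left, Top)]
  end.

(* The midpoints of the unit edges of the grid: [inl (i, j)] lies in row i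
   between columns j - 1 and j, and [inr (i, j)] lies in column j between rows
   i - 1 and i. *)
Notation midpoint n := ('I_n * 'I_n.+1 + 'I_n.+1 * 'I_n)%type.

Definition mid (n : nat) (i j : 'I_n) (s : side) : midpoint n :=
  match s with
  | Left => inl (i, widen_ord (leqnSn n) j)
  | Right => inl (i, lift ord0 j)
  | Top => inr (widen_ord (leqnSn n) i, j)
  | Bottom => inr (lift ord0 i, j)
  end.

Definition segment (n : nat) (D : 'M[tile]_n) : rel (midpoint n) := fun e e' =>
  [exists i, exists j,
    (e, e') \in [seq (mid i j s.1, mid i j s.2) | s <- tile_segments (D i j)]].

Definition on_bottom (n : nat) (e : midpoint n) : bool :=
  if e is inr (i, _) then i == ord_max else false.

Definition on_right (n : nat) (e : midpoint n) : bool :=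
  if e is inl (_, j) then j == ord_max else false.

Definition is_pipe (n : nat) (D : 'M[tile]_n) (p : seq (midpoint n)) : bool :=
  if p is e :: q then
    [&& on_bottom e, path (segment D) e q & on_right (last e q)]
  else false.

Definition uses_segment (n : nat) (e e' : midpoint n) (p : seq (midpoint n))
    : bool :=
  (e, e') \in zip p (behead p).

Definition is_bpd (n : nat) (D : 'M[tile]_n) : Prop :=
  exists P : n.-tuple (seq (midpoint n)),
    all (is_pipe D) P /\
    forall e e', segment D e e' -> count (uses_segment e e') P = 1%N.

Record bpd (n : nat) := BPD { bpd_tiling :> 'M[tile]_n; bpdP : is_bpd bpd_tiling }.

Definition bpd_mx (n : nat) (D : 'M[tile]_n) : 'M[int]_n :=
  \matrix_(i, j) match D i j with RTile => 1 | JTile => -1 | _ => 0 end.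

Section Trace.
Variables (T : finType) (st : rel T) (mu : T -> nat) (N : nat).
Hypothesis st_mu : forall x y, st x y -> (mu x < mu y)%N.
Hypothesis mu_N : forall x, (mu x < N)%N.
Hypothesis st_det : forall x y z, st x y -> st x z -> y = z.
Hypothesis st_codet : forall x y z, st x z -> st y z -> x = y.

Fixpoint trace (k : nat) (x : T) : seq T :=
  if k is k'.+1 then
    if [pick y | st x y] is Some y then y :: trace k' y else [::]
  else [::].

Lemma trace_path k x : path st x (trace k x).
Proof. by elim: k x => [|k IH] x //=; case: pickP => //= y ->; rewrite IH. Qed.

Lemma trace_last k x y : (N <= k + mu x)%N -> ~~ st (last x (trace k x)) y.
Proof.
elim: k x => [|k IH] x /=; first by have := mu_N x; lia.
by case: pickP => [z xz|H] kN /=; [apply: IH; have := st_mu xz; lia | rewrite H].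
Qed.

Lemma zip_path p x y z : path st x p -> (y, z) \in zip (x :: p) p ->
  connect st x y && st y z.
Proof.
elim: p x => [|u p IH] x //= /andP[xu up]; rewrite inE => /orP[/eqP[-> ->]|H].
  by rewrite connect0 xu.
case/andP: (IH u up H) => uy ->; rewrite andbT.
exact: connect_trans (connect1 xu) uy.
Qed.

Lemma trace_uses k x y z : (N <= k + mu x)%N -> connect st x y -> st y z ->
  (y, z) \in zip (x :: trace k x) (trace k x).
Proof.
move=> kN /connectP[p]; elim: p x k kN => [|u p IH] x [|k] kN /=;
  try (by have := mu_N x; lia).
  move=> _ -> xz; case: pickP => [w xw|/(_ z)]; last by rewrite xz.
  by rewrite (st_det xz xw) inE eqxx.
move=> /andP[xu up] yl yz; case: pickP => [w xw|/(_ u)]; last by rewrite xu.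
rewrite -(st_det xu xw) inE IH ?orbT //.
by have := st_mu xu; lia.
Qed.

Definition source x := forall y, ~~ st y x.

Lemma source_exists x : exists2 b, source b & connect st b x.
Proof.
have [m] := ubnP (mu x); elim: m x => // m IH x xm.
have [/existsP[y yx]|/existsPn H] := boolP [exists y, st y x]; last by exists x.
have [|b Sb bx] := IH y; first by have := st_mu yx; lia.
by exists b => //; apply: connect_trans bx (connect1 yx).
Qed.

Lemma source_uniq b c x : source b -> source c -> connect st b x ->
  connect st c x -> b = c.
Proof.
move=> Sb Sc /connectP[p]; elim/last_ind: p x => [|p u IH] x.
  move=> _ -> /connectP[q]; case/lastP: q => [|q v] //.
  by rewrite rcons_path last_rcons => /andP[_ +] E; rewrite -E (negPf (Sb _)).
rewrite rcons_path last_rcons => /andP[bp pu] -> /connectP[q].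
case/lastP: q => [|q v] /=; first by move=> _ E; rewrite E (negPf (Sc _)) in pu.
rewrite rcons_path last_rcons => /andP[cq qv] E; rewrite -E in qv.
apply: (IH _ bp erefl); apply/connectP; exists q => //.
exact: st_codet pu qv.
Qed.

End Trace.

Section Tilings.
Variable n : nat.
Implicit Types (D : 'M[tile]_n) (e : midpoint n).

Definition meets_left t :=
  match t with Horizontal | Crossing | JTile => true | _ => false end.
Definition meets_right t :=
  match t with Horizontal | Crossing | RTile => true | _ => false end.
Definition meets_top t :=
  match t with Vertical | Crossing | JTile => true | _ => false end.
Definition meets_bottom t :=
  match t with Vertical | Crossing | RTile => true | _ => false end.

Definition out_side t s : option side :=
  match t, s with
  | Horizontal, Left | Crossing, Left | RTile, Bottom => Some Right
  | Vertical, Bottom | Crossing, Bottom | JTile, Left => Some Top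
  | _, _ => None
  end.

Lemma segmentP D e e' :
  reflect (exists i j s s', [/\ e = mid i j s, e' = mid i j s'
                              & out_side (D i j) s = Some s'])
          (segment D e e').
Proof.
apply: (iffP existsP) => [[i /existsP[j]]|[i [j [s [s' [-> -> H]]]]]].
  case E: (D i j) => /=; rewrite ?inE //; try case/orP; move=> /eqP[-> ->];
    exists i, j; (by exists Left, Right; rewrite E) || (by exists Bottom, Top; rewrite E)
    || (by exists Bottom, Right; rewrite E) || (by exists Left, Top; rewrite E).
exists i; apply/existsP; exists j.
by case: (D i j) s H => -[] //= [<-] /=; rewrite !inE eqxx ?orbT.
Qed.

Definition mid_pair e : bool * (nat * nat) :=
  match e with inl (i, j) => (true, (val i, val j))
             | inr (i, j) => (false, (val i, val j)) end.

Lemma mid_pair_inj : injective mid_pair.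
Proof.
by move=> [[i j]|[i j]] [[i' j']|[i' j']] //= [] /val_inj-> /val_inj->.
Qed.

Lemma mid_in (i j i' j' : 'I_n) t t' s s' u u' :
    out_side t s = Some u -> out_side t' s' = Some u' ->
  mid i j s = mid i' j' s' -> [/\ i = i', j = j' & s = s'].
Proof.
move=> H H' /(congr1 mid_pair).
case: s H => H; try (by case: t H); case: s' H' => H'; try (by case: t' H');
  by rewrite /= ?/bump /= ?add1n => -[] /val_inj-> /val_inj->.
Qed.

Lemma mid_out (i j i' j' : 'I_n) t t' s s' u u' :
    out_side t s = Some u -> out_side t' s' = Some u' ->
  mid i j u = mid i' j' u' -> [/\ i = i', j = j' & u = u'].
Proof.
move=> H H' /(congr1 mid_pair).
case: u H => H; try (by case: t s H => -[]);
  case: u' H' => H'; try (by case: t' s' H' => -[]);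
  by rewrite /= ?/bump /= ?add1n => -[] /val_inj-> /val_inj->.
Qed.

Lemma segment_det D x y z : segment D x y -> segment D x z -> y = z.
Proof.
move=> /segmentP[i [j [s [s' [-> -> H]]]]] /segmentP[k [l [u [u' [E -> H']]]]].
by case: (mid_in H H' E) (H') => <- <- <-; rewrite H => -[<-].
Qed.

Lemma segment_codet D x y z : segment D x z -> segment D y z -> x = y.
Proof.
move=> /segmentP[i [j [s [s' [-> -> H]]]]] /segmentP[k [l [u [u' [-> E H']]]]].
have [Ei Ej F] := mid_out H H' E; move: H H' {E}; rewrite -Ei -Ej -F.
by case: (D i j); case: s => //=; case: u => //= -[<-].
Qed.

Definition level (e : midpoint n) : nat :=
  match e with inl (i, j) => (2 * (j + (n - i)))%N
             | inr (i, j) => (2 * (j + (n - i))).+1 end.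

Lemma segment_level D x y : segment D x y -> (level x < level y)%N.
Proof.
move=> /segmentP[i [j [s [s' [-> -> H]]]]].
have := ltn_ord i; have := ltn_ord j.
by case: (D i j) s H => -[] //= [<-] /=; rewrite /bump /=; lia.
Qed.

Lemma level_lt e : (level e < 4 * n + 4)%N.
Proof. by case: e => -[i j] /=; have := ltn_ord i; have := ltn_ord j; lia. Qed.

(* The local conditions satisfied by a bumpless pipe dream. *)
Definition locally_bpd D : Prop :=
  [/\ forall i j j' : 'I_n, j' = j.+1 :> nat ->
        meets_left (D i j') = meets_right (D i j),
      forall i j : 'I_n, j = 0%N :> nat -> meets_left (D i j) = false,
      forall i i' j : 'I_n, i' = i.+1 :> nat ->
        meets_top (D i' j) = meets_bottom (D i j),
      forall i j : 'I_n, i = 0%N :> nat -> meets_top (D i j) = false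
    & forall i j : 'I_n, i.+1 = n -> meets_bottom (D i j)].

Lemma seg_left D i j : reflect (exists e, segment D (mid i j Left) e)
  (meets_left (D i j)).
Proof.
apply: (iffP idP) => [H|[e /segmentP[k [l [s [s' [E _ H]]]]]]].
  by case E: (D i j) H => // _; [exists (mid i j Right)|exists (mid i j Right)|
    exists (mid i j Top)]; apply/segmentP; exists i, j, Left;
    eexists; split; rewrite ?E.
have X : out_side JTile Left = Some Top by [].
by case: (mid_in X H E) (H) => <- <- <-; case: (D i j).
Qed.

Lemma seg_bottom D i j : reflect (exists e, segment D (mid i j Bottom) e)
  (meets_bottom (D i j)).
Proof.
apply: (iffP idP) => [H|[e /segmentP[k [l [s [s' [E _ H]]]]]]].
  by case E: (D i j) H => // _; [exists (mid i j Top)|exists (mid i j Top)|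
    exists (mid i j Right)]; apply/segmentP; exists i, j, Bottom;
    eexists; split; rewrite ?E.
have X : out_side RTile Bottom = Some Right by [].
by case: (mid_in X H E) (H) => <- <- <-; case: (D i j).
Qed.

Lemma seg_right D i j : reflect (exists e, segment D e (mid i j Right))
  (meets_right (D i j)).
Proof.
apply: (iffP idP) => [H|[e /segmentP[k [l [s [s' [_ E H]]]]]]].
  by case E: (D i j) H => // _; [exists (mid i j Left)|exists (mid i j Left)|
    exists (mid i j Bottom)]; apply/segmentP; exists i, j;
    eexists; exists Right; split; rewrite ?E.
have X : out_side RTile Bottom = Some Right by [].
have [Ei Ej F] := mid_out X H E; move: H {E}; rewrite -Ei -Ej -F.
by case: (D i j); case: s.
Qed.

Lemma seg_top D i j : reflect (exists e, segment D e (mid i j Top))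
  (meets_top (D i j)).
Proof.
apply: (iffP idP) => [H|[e /segmentP[k [l [s [s' [_ E H]]]]]]].
  by case E: (D i j) H => // _; [exists (mid i j Bottom)|
    exists (mid i j Bottom)|exists (mid i j Left)]; apply/segmentP; exists i, j;
    eexists; exists Top; split; rewrite ?E.
have X : out_side JTile Left = Some Top by [].
have [Ei Ej F] := mid_out X H E; move: H {E}; rewrite -Ei -Ej -F.
by case: (D i j); case: s.
Qed.

Lemma mid_succ_col (i j j' : 'I_n) : j' = j.+1 :> nat ->
  mid i j' Left = mid i j Right.
Proof. by move=> E; apply: mid_pair_inj; rewrite /= E. Qed.

Lemma mid_succ_row (i i' j : 'I_n) : i' = i.+1 :> nat ->
  mid i' j Top = mid i j Bottom.
Proof. by move=> E; apply: mid_pair_inj; rewrite /= E. Qed.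

Lemma bpd_local D : is_bpd D -> locally_bpd D.
Proof.
case=> P [/allP Ppipe Pcount].
have usedP e e' : segment D e e' -> exists2 p, p \in P & uses_segment e e' p.
  by move=> /Pcount H; apply/hasP; rewrite has_count H.
have pred e e' : segment D e e' -> on_bottom e \/ exists d, segment D d e.
  move=> /usedP[[|b q] /Ppipe //= /and3P[Sb bq _]]; rewrite /uses_segment /=.
  elim: q b bq {Sb}(or_introl _ Sb : on_bottom b \/ exists d, segment D d b)
    => [|u q IH] b //= /andP[bu uq] Hb; rewrite inE => /orP[/eqP[-> _] //|].
  by apply: IH => //; right; exists b.
have succ e e' : segment D e e' -> on_right e' \/ exists f, segment D e' f.
  move=> /usedP[[|b q] /Ppipe //= /and3P[_ bq]]; rewrite /uses_segment /=.
  elim: q b bq => [|u q IH] b //= /andP[bu uq] Hb.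
  rewrite inE => /orP[/eqP[_ ->]|]; last exact: IH.
  by case: q {IH} uq Hb => [|v q] /=; [left|case/andP=> uv _ _; right; exists v].
split.
- move=> i j j' jj'; apply/idP/idP.
    move=> /seg_left[e H]; apply/seg_right.
    by case: (pred _ _ H) => // -[d]; rewrite (mid_succ_col _ jj'); exists d.
  move=> /seg_right[e H]; apply/seg_left; rewrite (mid_succ_col _ jj').
  case: (succ _ _ H) => // /eqP /(congr1 val) /=; rewrite /bump /=.
  by have := ltn_ord j'; lia.
- move=> i j j0; apply/negP=> /seg_left[e H].
  case: (pred _ _ H) => // -[d] /segmentP[k [l [s [s' [_ E K]]]]].
  move: E => /(congr1 mid_pair).
  by case: s' K => //=; [case: (D k l); case: s | move=> _ []; rewrite /bump; lia].
- move=> i i' j ii'; apply/idP/idP.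
    move=> /seg_top[e H]; apply/seg_bottom; rewrite -(mid_succ_row _ ii').
    by case: (succ _ _ H).
  move=> /seg_bottom[e H]; apply/seg_top; rewrite (mid_succ_row _ ii').
  case: (pred _ _ H) => // /eqP /(congr1 val) /=; rewrite /bump /=.
  by have := ltn_ord i'; lia.
- move=> i j i0; apply/negP=> /seg_top[e H].
  case: (succ _ _ H) => // -[d] /segmentP[k [l [s [s' [E _ K]]]]].
  move: E => /(congr1 mid_pair).
  by case: s K => //=; [case: (D k l) | move=> _ []; rewrite /bump; lia].
move=> i j iN; apply/seg_bottom.
pose next (k : 'I_n) := nth (mid i j Bottom) (tnth P k) 1.
pose col (k : 'I_n) := if tnth P k is inr (_, l) :: _ then l else j.
have headP k : exists q, tnth P k = mid i (col k) Bottom :: next k :: q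
    /\ segment D (mid i (col k) Bottom) (next k).
  have := Ppipe _ (mem_tnth k P); rewrite /next /col.
  case: (tnth P k) => [|[[a b]|[a b]] [|f q]] //=; first by rewrite andbF.
  move=> /and3P[/eqP -> /andP[H _] _]; exists q.
  have <- : ord_max = lift ord0 i by apply: val_inj; rewrite /= /bump /= add1n iN.
  by [].
have col_inj : injective col.
  move=> k l kl; have [q [Ek Hk]] := headP k; have [r [El Hl]] := headP l.
  rewrite -kl in Hl El; have nkl := segment_det Hk Hl; rewrite -nkl in El.
  have := Pcount _ _ Hk; apply: contra_eq => kNl.
  have -> : tval P = [seq tnth P x | x <- enum 'I_n].
    by rewrite -[LHS]map_tnth_enum.
  rewrite count_map -size_filter neq_ltn; apply/orP; right.
  apply: (@leq_trans (size [:: k; l])) => //; apply: uniq_leq_size.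
    by rewrite /= inE kNl.
  move=> x; rewrite mem_filter mem_enum andbT !inE /= => /orP[] /eqP->.
    by rewrite /uses_segment Ek /= inE eqxx.
  by rewrite /uses_segment El /= inE eqxx.
have [k kj] : exists k, col k = j.
  by have [g gK Kg] := injF_bij col_inj; exists (g j).
by have [_ [_ H]] := headP k; rewrite kj in H; exists (next k).
Qed.

Lemma local_bpd D : locally_bpd D -> is_bpd D.
Proof.
case=> LR L0 TB T0 Bn.
pose N := (4 * n + 4)%N.
have n_pos (j : 'I_n) : (0 < n)%N by apply: leq_ltn_trans (ltn_ord j).
pose bot (j : 'I_n) : midpoint n := inr (ord_max, j).
pose P := [tuple bot j :: trace (segment D) N (bot j) | j < n].
have seg_pred e e' : segment D e e' -> on_bottom e \/ exists d, segment D d e.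
  move=> /segmentP[i [j [s [s' [-> _ H]]]]].
  case: s H => H; try by case: (D i j) H.
    have Lij : meets_left (D i j) by case: (D i j) H.
    right; case E: (val j) => [|k]; first by rewrite L0 in Lij.
    have kn : (k < n)%N by have := ltn_ord j; rewrite /= in E; lia.
    have jk : j = (Ordinal kn).+1 :> nat by [].
    rewrite (mid_succ_col _ jk); apply/seg_right.
    by rewrite -(LR _ _ _ jk).
  have Bij : meets_bottom (D i j) by case: (D i j) H.
  have [iN|iN] := ltnP i.+1 n; last first.
    left; rewrite /=; apply/eqP/val_inj; rewrite /= /bump /=.
    by have := ltn_ord i; lia.
  right; have ii : Ordinal iN = i.+1 :> nat by [].
  by rewrite -(mid_succ_row _ ii); apply/seg_top; rewrite (TB _ _ _ ii).
have seg_succ e e' : segment D e e' -> on_right e' \/ exists f, segment D e' f.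
  move=> /segmentP[i [j [s [s' [_ -> H]]]]].
  case: s' H => H; try by case: (D i j) s H => -[].
    have Rij : meets_right (D i j) by case: (D i j) s H => -[].
    have [jN|jN] := ltnP j.+1 n; last first.
      left; rewrite /=; apply/eqP/val_inj; rewrite /= /bump /=.
      by have := ltn_ord j; lia.
    right; have jj : Ordinal jN = j.+1 :> nat by [].
    by rewrite -(mid_succ_col _ jj); apply/seg_left; rewrite (LR _ _ _ jj).
  have Tij : meets_top (D i j) by case: (D i j) s H => -[].
  right; case E: (val i) => [|k]; first by rewrite T0 in Tij.
  have kn : (k < n)%N by have := ltn_ord i; rewrite /= in E; lia.
  have ik : i = (Ordinal kn).+1 :> nat by [].
  rewrite (mid_succ_row _ ik); apply/seg_bottom.
  by rewrite -(TB _ _ _ ik).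
have bot_source j : source (segment D) (bot j).
  move=> e; apply/negP=> /segmentP[k [l [s [s' [_ E H]]]]].
  move: E => /(congr1 mid_pair).
  case: s' H => H //=; try by case: (D k l) s H => -[].
  by case=> E _; have := ltn_ord k; lia.
have bot_seg j : exists e, segment D (bot j) e.
  have lastn : (n.-1 < n)%N by rewrite prednK // n_pos.
  have -> : bot j = mid (Ordinal lastn) j Bottom.
    by apply: mid_pair_inj; rewrite /= /bump /= add1n prednK // (n_pos j).
  by apply/seg_bottom/Bn; rewrite /= prednK // (n_pos j).
have fuel e : (N <= N + level e)%N by apply: leq_addr.
exists P; split.
  apply/allP=> _ /mapP[j _ ->]; apply/and3P; split; first exact: eqxx.
    exact: trace_path.
  set q := trace _ _ _.
  have Hlast f : ~~ segment D (last (bot j) q) f.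
    exact: (trace_last (@segment_level D) (@level_lt)).
  have : path (segment D) (bot j) q by apply: trace_path.
  case/lastP: q Hlast => [|q u] Hlast.
    by have [f] := bot_seg j; rewrite (negPf (Hlast f)).
  rewrite rcons_path last_rcons => /andP[_ /seg_succ[//|[f]]].
  by have := Hlast f; rewrite last_rcons => /negPf->.
move=> e e' ee'.
have [b Sb be] := source_exists (@segment_level D) e.
have [j bj] : exists j, b = bot j.
  have [f bf] : exists f, segment D b f.
    move: be => /connectP[[|u p] /= ]; first by move=> _ <-; exists e'.
    by move=> /andP[bu _] _; exists u.
  case: (seg_pred _ _ bf) => [|[d]]; last by rewrite (negPf (Sb d)).
  by case: (b) => -[i j] //= /eqP->; exists j.
rewrite count_map -(eq_count (a1 := pred1 j)); last first.
  move=> k /=; apply/eqP/idP => [->|].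
    rewrite /uses_segment /= -bj.
    exact: (trace_uses (@segment_level D) (@level_lt) (@segment_det D)).
  rewrite /uses_segment /= => /(zip_path (trace_path _ _ _)) /andP[ke _].
  have := source_uniq (@segment_codet D) (bot_source k) (bot_source j) ke.
  by rewrite -bj => /(_ be); rewrite bj => -[].
by rewrite count_uniq_mem ?enum_uniq // mem_enum.
Qed.

Lemma bpd_row_psum D (i j : 'I_n) : locally_bpd D ->
  row_psum (bpd_mx D) i j = (meets_right (D i j))%:Z.
Proof.
case=> LR L0 _ _ _; rewrite -[LHS]/(psum (bpd_mx D i) j.+1) psumS mxE.
case: j => j jn /=; elim: j jn => [|j IH] jn.
  rewrite psum0 add0r.
  by have := L0 i (Ordinal jn) erefl; case: (D i (Ordinal jn)).
rewrite (psumS _ (Ordinal (ltnW jn))) /= mxE IH.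
have <- := LR i (Ordinal (ltnW jn)) (Ordinal jn) erefl.
by case: (D i (Ordinal jn)).
Qed.

Lemma bpd_col_psum D (i j : 'I_n) : locally_bpd D ->
  col_psum (bpd_mx D) i j = (meets_bottom (D i j))%:Z.
Proof.
case=> _ _ TB T0 _; rewrite -[LHS]/(psum ((bpd_mx D)^~ j) i.+1) psumS mxE.
case: i => i jn /=; elim: i jn => [|i IH] jn.
  rewrite psum0 add0r.
  by have := T0 (Ordinal jn) j erefl; case: (D (Ordinal jn) j).
rewrite (psumS _ (Ordinal (ltnW jn))) /= mxE IH.
have <- := TB (Ordinal (ltnW jn)) (Ordinal jn) j erefl.
by case: (D (Ordinal jn) j).
Qed.

Lemma bpd_mx_is_asm (D : bpd n) : is_asm (bpd_mx D).
Proof.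
have locD := bpd_local (bpdP D); apply/and4P; split.
- by apply/forallP=> i; apply/forallP=> j; rewrite mxE; case: (D i j).
- apply/forallP=> i; apply/forallP=> j; rewrite (bpd_row_psum i j locD).
  by case: meets_right.
- apply/forallP=> i; apply/forallP=> j; rewrite (bpd_col_psum i j locD).
  by case: meets_bottom.
rewrite exchange_big /= (eq_bigr (fun=> 1)) => [|j _].
  by rewrite sumr_const card_ord natz.
have n0 : (n.-1 < n)%N by rewrite prednK // (leq_ltn_trans _ (ltn_ord j)).
have lastE : (Ordinal n0).+1 = n by rewrite /= prednK // (leq_ltn_trans _ (ltn_ord j)).
have <- : col_psum (bpd_mx D) (Ordinal n0) j = 1.
  by rewrite (bpd_col_psum _ _ locD); case: locD => _ _ _ _ /(_ _ j lastE) ->.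
by apply: eq_bigl => i; have := ltn_ord i; rewrite -[X in (_ < X)%N]lastE ltnS => ->.
Qed.

Definition bpd_to_asm (D : bpd n) : asm n := ASM (bpd_mx_is_asm D).

Lemma bpd_to_asm_inj (D E : bpd n) :
  bpd_to_asm D = bpd_to_asm E -> D = E :> 'M[tile]_n.
Proof.
move=> /(congr1 (@asm_mx n)) /= DE; apply/matrixP=> i j.
have /(congr1 (fun M : 'M[int]_n => M i j)) := DE; rewrite !mxE.
have := bpd_row_psum i j (bpd_local (bpdP D)).
have := bpd_col_psum i j (bpd_local (bpdP D)).
rewrite DE (bpd_row_psum i j (bpd_local (bpdP E))).
rewrite (bpd_col_psum i j (bpd_local (bpdP E))).
by case: (D i j); case: (E i j).
Qed.

Lemma bpd_to_asm_onto (A : asm n) : {D : bpd n | bpd_to_asm D = A}.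
Proof.
pose R i j := psum (A i) j; pose C i j := psum (A^~ j) i.
pose D : 'M[tile]_n := \matrix_(i, j)
  if A i j == 1 then RTile else if A i j == -1 then JTile else
  if R i j.+1 == 1 then (if C i.+1 j == 1 then Crossing else Horizontal)
  else if C i.+1 j == 1 then Vertical else Blank.
have [RS CS] : (forall i j : 'I_n, R i j.+1 = R i j + A i j)
    /\ (forall i j : 'I_n, C i.+1 j = C i j + A i j).
  by split=> i j; [exact: psumS | exact: (psumS (A^~ j))].
have facts i j : [/\ (meets_left (D i j))%:Z = R i j,
    (meets_right (D i j))%:Z = R i j.+1, (meets_top (D i j))%:Z = C i j
    & (meets_bottom (D i j))%:Z = C i.+1 j].
  have := asm_row01 A i j; have := asm_row01 A i j.+1.
  have := asm_col01 A j i; have := asm_col01 A j i.+1.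
  rewrite -/(R i j) -/(R i j.+1) -/(C i j) -/(C i.+1 j) mxE.
  have := asm_entry A i j; have := RS i j; have := CS i j.
  case: (A i j =P 1) => [->|?]; first by split=> /=; lia.
  case: (A i j =P -1) => [->|?]; first by split=> /=; lia.
  by case: (R i j.+1 =P 1) => ?; case: (C i.+1 j =P 1) => ?; split=> /=; lia.
have locD : locally_bpd D.
  split.
  - move=> i j j' jj'; have [+ _ _ _] := facts i j'; have [_ + _ _] := facts i j.
    by rewrite jj' => <-; case: meets_left; case: meets_right.
  - move=> i j j0; have [+ _ _ _] := facts i j.
    by rewrite j0 /R psum0; case: meets_left.
  - move=> i i' j ii'; have [_ _ + _] := facts i' j; have [_ _ _ +] := facts i j.
    by rewrite ii' => <-; case: meets_top; case: meets_bottom.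
  - move=> i j i0; have [_ _ + _] := facts i j.
    by rewrite i0 /C psum0; case: meets_top.
  move=> i j iN; have [_ _ _] := facts i j.
  have := csum_n A (leqnn n) (ltn_ord j).
  have := csum_n A (leqnn n) (ltnW (ltn_ord j)).
  rewrite !csumC psumS iN => ->; rewrite -/(C n j).
  by case: meets_bottom => //=; lia.
exists (BPD (local_bpd locD)); apply/val_inj/matrixP=> i j; rewrite /= mxE.
have [+ + _ _] := facts i j; rewrite RS => <-.
rewrite mxE; have := asm_entry A i j.
by case: (A i j =P 1) => [->|?] //; case: (A i j =P -1) => [->|?] //;
  case: ifP => _; case: ifP => _ /=; lia.
Qed.

(* The inverse of the bijection [bpd_to_asm]. *)
Definition Phi (A : asm n) : bpd n := sval (bpd_to_asm_onto A).

End Tilings.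

Definition passes_column (n : nat) (D : bpd n) (r j : 'I_n) : Prop :=
  exists2 p, is_pipe D p & mid r j Right \in p.

Definition liftable_column_crossing (n : nat) (D : bpd n) (i : 'I_n) : Prop :=
  exists i' j : 'I_n,
    [/\ i' = i.+1 :> nat, (j.+1 < n)%N, passes_column D i' j
      & ~ passes_column D i j].

(* Main.v *)
Require Import Defs.
From mathcomp Require Import all_boot all_order all_algebra.
From mathcomp Require Import zify.

Set Implicit Arguments.
Unset Strict Implicit.
Unset Printing Implicit Defensive.

Import Order.TTheory GRing.Theory.
Local Open Scope ring_scope.

(** Fix a row [i] and compare three consecutive rows of corner sums, read as
    functions of the number [b] of columns: [x b = csum A i b],
    [y b = csum A i.+1 b] and [z b = csum A i.+2 b], the middle one being the
    row that [pi_i] may change.  Each row grows by 0 or 1 with [b], and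
    [x <= y <= x + 1], [y <= z <= y + 1].  Call [b] liftable when [y b = x b]
    and [z b = y b + 1], that is when the neighbouring rows leave room to
    increase [y b].  Each of the six conditions says that no [b] is liftable.

    For the rows of [m_{A^T}], and for the column crossings of [Phi A], this is
    a translation: in both cases [b] is liftable iff row [i] of [A] has partial
    sum 0 and row [i + 1] has partial sum 1 after [b] columns.

    The other conditions rest on [liftable_corner]: if some position is
    liftable, then so is one where [y] has a corner, being constant just before
    and increasing just after.  At a corner, increasing [y] by one yields again
    the corner sums of an alternating sign matrix ([raise_corner]).  Hence a
    liftable position contradicts the minimality of [A] in its fibre, and
    conversely [y] is pointwise maximal when nothing is liftable
    ([asm_pi_fixP]).  A corner is also exactly what an essential cell in row [i]
    records ([essential_cellP]).  For monotone triangles, the entry [m(i, j)] is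
    less than [k] iff the corner sum after [k] columns exceeds [j]
    ([triangle_lt]), so that decreasing one entry of the triangle amounts to
    increasing one corner sum ([essential_pointP]).

    Finally, [A] is a value of [pi_i] on another matrix as soon as
    [pi_i A = A], because every fibre has at least two elements: its smallest
    choice of the middle row, [max x (z - 1)], differs from the largest one,
    [min (x + 1) z], wherever [z = x + 1], and this happens somewhere since
    [z - x] goes from 0 to 2 by steps of at most 1 ([middle_gap]). *)

(** * Corner sums *)

Lemma csumSl (n : nat) (A : 'M[int]_n) (a : 'I_n) b :
  csum A a.+1 b = csum A a b + psum (A a) b.
Proof. exact: psumS. Qed.

Lemma csumSr (n : nat) (A : 'M[int]_n) a (b : 'I_n) :
  csum A a b.+1 = csum A a b + psum (A^~ b) a.
Proof. by rewrite !csumC psumS. Qed.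

Lemma corner_sumE (n : nat) (A : 'M[int]_n) (a b : 'I_n) :
  corner_sum A a b = csum A a.+1 b.+1.
Proof. by []. Qed.

Lemma csum_tr (n : nat) (A : 'M[int]_n) a b : csum A^T a b = csum A b a.
Proof.
rewrite [RHS]csumC; apply: eq_bigr => x _.
by apply: eq_bigr => y _; rewrite mxE.
Qed.

Lemma is_asm_tr (n : nat) (A : asm n) : is_asm A^T.
Proof.
case/and4P: (asmP A) => /forallP E /forallP R /forallP C S; apply/and4P; split.
- apply/forallP=> i; apply/forallP=> j; rewrite mxE.
  exact: (forallP (E j) i).
- apply/forallP=> i; apply/forallP=> m.
  have <- : col_psum A m i = row_psum A^T i m.
    by apply: eq_bigr => x _; rewrite mxE.
  exact: (forallP (C m) i).
- apply/forallP=> m; apply/forallP=> j.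
  have <- : row_psum A j m = col_psum A^T m j.
    by apply: eq_bigr => x _; rewrite mxE.
  exact: (forallP (R j) m).
rewrite exchange_big /= -(eqP S); apply/eqP.
by apply: eq_bigr => x _; apply: eq_bigr => y _; rewrite mxE.
Qed.

Definition asm_tr (n : nat) (A : asm n) : asm n := ASM (is_asm_tr A).

Section CornerSums.
Variables (n : nat) (A : asm n).

Lemma csum_wide a b : (a <= n)%N -> (n <= b)%N -> csum A a b = a%:Z.
Proof. by move=> an nb; rewrite -csum_tr; apply: (csum_n (asm_tr A)). Qed.

Lemma csum_monoH a b c : (b <= c)%N -> csum A a b <= csum A a c.
Proof.
move=> /subnKC <-; elim: (c - b)%N => [|k IH]; first by rewrite addn0.
by rewrite addnS; have := asm_stepH A a (b + k); lia.
Qed.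

Lemma csum_ge0 a b : 0 <= csum A a b.
Proof. by rewrite -(csum0r A a) csum_monoH. Qed.

Lemma csum_le a b : csum A a b <= a%:Z.
Proof.
elim: a => [|a IH]; first by rewrite csum0l.
by have := asm_stepV A a b; lia.
Qed.

Lemma csum_inj (B : asm n) :
    (forall a b, (a <= n)%N -> (b <= n)%N -> csum A a b = csum B a b) -> A = B.
Proof.
move=> H; apply/val_inj/matrixP=> i j /=.
have entry (C : 'M[int]_n) : C i j =
    csum C i.+1 j.+1 - csum C i j.+1 - (csum C i.+1 j - csum C i j).
  by rewrite !csumSl psumS; lia.
by rewrite !entry !H // ltnW.
Qed.

End CornerSums.

(** * Liftable positions *)

Section Liftable.
Variables (n : nat) (A : asm n) (i : nat).
Hypothesis hi : (i.+1 < n)%N.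

(** The middle row of corner sums can be raised at [b] as far as the two
    neighbouring rows are concerned; raising it may still break the step
    condition inside the row, which is what [lift_corner] excludes. *)
Definition liftable (b : nat) : bool :=
  (csum A i.+1 b == csum A i b) && (csum A i.+2 b == csum A i.+1 b + 1).

(** The corner itself is at [p.+1]: a liftable position is never 0. *)
Definition lift_corner (p : nat) : Prop :=
  [/\ (p.+1 < n)%N, liftable p.+1, csum A i.+1 p = csum A i.+1 p.+1
    & csum A i.+1 p.+2 = csum A i.+1 p.+1 + 1].

Lemma liftable_bounds b : liftable b -> (0 < b < n)%N.
Proof.
case/andP=> /eqP E1 /eqP E2; apply/andP; split.
  by case: b E1 E2 => //; rewrite !csum0r.
by rewrite ltnNge; apply/negP=> nb; move: E1; rewrite !csum_wide //; lia.
Qed.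

(** At the least liftable position the middle row has just been constant: had
    it just increased, the position before would already be liftable.  Moving
    right as long as the row stays constant preserves liftability, because the
    two neighbouring rows are nondecreasing; and the row must increase
    eventually, its last value being [i + 1]. *)
Lemma liftable_corner b : liftable b -> exists p, lift_corner p.
Proof.
move=> Lb; have exL : exists b, liftable b by exists b.
case: (ex_minnP exL) => -[/liftable_bounds//|{Lb}b] Lb1 minb.
have step : csum A i.+1 b = csum A i.+1 b.+1.
  have := minb b; rewrite ltnn; move: Lb1; rewrite /liftable.
  have := asm_stepV A i b; have := asm_stepV A i.+1 b.
  have := asm_stepH A i b; have := asm_stepH A i.+1 b.
  have := asm_stepH A i.+2 b.
  lia.
(* [c] will be the last position of the plateau that starts at [b.+1]. *)
have exG : exists c, csum A i.+1 b.+1 < csum A i.+1 c.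
  exists n; rewrite [ltRHS]csum_wide ?(ltnW hi) //.
  by case/andP: Lb1 => /eqP -> _; have := csum_le A i b.+1; lia.
case: (ex_minnP exG) => c; case: c => [|c] lt_c minc.
  by have := csum_monoH A i.+1 (leq0n b.+1); lia.
have bc : (b.+1 <= c)%N.
  by rewrite leqNgt; apply/negP=> cb; have := csum_monoH A i.+1 cb; lia.
have eq_c : csum A i.+1 c = csum A i.+1 b.+1.
  have := csum_monoH A i.+1 bc; have := minc c; rewrite ltnn; lia.
have Lc : liftable c.
  move: Lb1; rewrite /liftable eq_c.
  have := csum_monoH A i bc; have := csum_monoH A i.+2 bc.
  have := asm_stepV A i c; have := asm_stepV A i.+1 c; rewrite eq_c; lia.
have := liftable_bounds Lc.
case: c lt_c minc bc eq_c Lc => // c lt_c minc bc eq_c Lc.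
move=> /andP[_ cn]; exists c; split=> //; last first.
  have := asm_stepH A i.+1 c.+1; lia.
rewrite eq_c; move: bc; rewrite leq_eqVlt => /orP[/eqP[<-]//|bc].
have := csum_monoH A i.+1 (bc : (b.+1 <= c)%N).
have := asm_stepH A i.+1 c; lia.
Qed.

(** A corner leaves room in all four directions, so the raised corner sums
    still have steps 0 and 1. *)
Lemma raise_corner p : lift_corner p ->
  exists B : asm n, forall a b, (a <= n)%N -> (b <= n)%N ->
    csum B a b = csum A a b + ((a == i.+1) && (b == p.+1))%:Z.
Proof.
case=> pn /andP[/eqP Ex /eqP Ez] El Er.
pose G a b := csum A a b + ((a == i.+1) && (b == p.+1))%:Z.
have [] := @asm_of_height n G; last by move=> B HB; exists B.
- by move=> b; rewrite /G csum0l.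
- by move=> a; rewrite /G csum0r andbF.
- move=> a b; rewrite /G eqSS; have := asm_stepV A a b.
  case: (b =P p.+1) => [->|_]; rewrite ?andbF ?andbT /=; last by lia.
  case: (a =P i) => [->|_]; first by rewrite ltn_eqF //=; lia.
  by case: (a =P i.+1) => [->|_] /=; lia.
- move=> a b; rewrite /G eqSS; have := asm_stepH A a b.
  case: (a =P i.+1) => [->|_] /=; last by lia.
  case: (b =P p) => [->|_]; last by case: (b =P p.+1) => [->|_] /=; lia.
  rewrite ltn_eqF //=; lia.
by rewrite /G csum_nn // (gtn_eqF hi) /= addr0.
Qed.

End Liftable.

(** * The fibres of [pi_i] *)

Section Fibres.
Variables (n : nat) (i : 'I_n).
Hypothesis hi : (i.+1 < n)%N.
Implicit Types A B C : asm n.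

Lemma agree_off_rowP A B : agree_off_row i A B <->
  forall a b, (a <= n)%N -> (b <= n)%N -> a != i.+1 -> csum B a b = csum A a b.
Proof.
split=> [H [|a] [|b] an bn|H a b ai]; rewrite ?csum0l ?csum0r //.
  by rewrite eqSS => ai; apply: (H (Ordinal an) (Ordinal bn)).
exact: (H a.+1 b.+1).
Qed.

Lemma agree_off_row_sym A B : agree_off_row i A B -> agree_off_row i B A.
Proof. by move=> H a b ai; rewrite H. Qed.

Lemma agree_off_row_trans A B C :
  agree_off_row i A B -> agree_off_row i B C -> agree_off_row i A C.
Proof. by move=> H K a b ai; rewrite K // H. Qed.

Lemma strong_le_anti A B : strong_le A B -> strong_le B A -> A = B.
Proof.
move=> AB BA; apply: csum_inj => -[|a] [|b] an bn; rewrite ?csum0l ?csum0r //.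
have := AB (Ordinal an) (Ordinal bn); have := BA (Ordinal an) (Ordinal bn).
by rewrite !corner_sumE /=; lia.
Qed.

Lemma asm_pi_uniq A B : is_pi i A B -> asm_pi i A = B.
Proof.
rewrite /asm_pi; case: (pi_exists i A) => C [/= fibC Cmin] [AB Bmin].
by apply: strong_le_anti; [apply: Cmin | apply: Bmin].
Qed.

Lemma asm_piP A : is_pi i A (asm_pi i A).
Proof. exact: (svalP (pi_exists i A)). Qed.

Lemma asm_pi_agree A B : agree_off_row i A B -> asm_pi i A = asm_pi i B.
Proof.
move=> AB; apply: asm_pi_uniq; have [BC Cmin] := asm_piP B; split.
  exact: agree_off_row_trans BC.
move=> C fibC; apply: Cmin; apply: agree_off_row_trans fibC.
exact: agree_off_row_sym.
Qed.

(** The strong order reverses corner sums, so the minimum of a fibre has the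
    largest middle row, and [y] equals the upper bound [min (x + 1) z] exactly
    where it is not liftable. *)
Lemma asm_pi_fixP A :
  asm_pi i A = A <-> forall b, ~~ liftable A i b.
Proof.
split=> [fixA b|L].
  apply/negP=> /(liftable_corner hi)[p cp].
  have [pn _ _ _] := cp; have [B HB] := raise_corner hi cp.
  have [_ /(_ B)] := asm_piP A; rewrite fixA => minA.
  have AB : agree_off_row i A B.
    by apply/agree_off_rowP => a b' an bn ai; rewrite HB // (negPf ai) addr0.
  have := minA AB i (Ordinal (ltnW pn)).
  by rewrite !corner_sumE HB ?(ltnW pn) //= !eqxx; lia.
apply: asm_pi_uniq; split=> [a b //|C /agree_off_rowP fibC a b].
rewrite !corner_sumE.
have bn := ltn_ord b; have an := ltn_ord a.
case: (a.+1 =P i.+1) => [->|/eqP ai]; last by rewrite fibC.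
have := L b.+1; rewrite /liftable.
have := fibC i b.+1 (ltnW (ltn_ord i)) bn; rewrite ltn_eqF // => /(_ isT).
have := fibC i.+2 b.+1 hi bn; rewrite gtn_eqF // => /(_ isT).
have := asm_stepV C i b.+1; have := asm_stepV C i.+1 b.+1.
have := asm_stepV A i b.+1; have := asm_stepV A i.+1 b.+1.
lia.
Qed.

(** This is the maximum of the fibre in the strong order.  The pointwise maximum
    of the two lower bounds that the neighbouring rows impose has steps 0 and 1,
    because both bounds do. *)
Lemma lowest_corner_row A : exists2 C : asm n, agree_off_row i A C &
  forall b, (b <= n)%N ->
    csum C i.+1 b = Num.max (csum A i b) (csum A i.+2 b - 1).
Proof.
pose G a b : int := if a == i.+1 then Num.max (csum A i b) (csum A i.+2 b - 1)
                    else csum A a b.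
have [|||||C HC] := @asm_of_height n G.
- by move=> b; rewrite /G csum0l.
- by move=> a; rewrite /G !csum0r; case: ifP.
- move=> a b; rewrite /G eqSS.
  have := asm_stepV A a b; have := asm_stepV A i b; have := asm_stepV A i.+1 b.
  case: (a =P i) => [->|_]; first by rewrite ltn_eqF //; lia.
  by case: (a =P i.+1) => [->|_]; lia.
- move=> a b; rewrite /G; have := asm_stepH A a b.
  have := asm_stepH A i b; have := asm_stepH A i.+2 b.
  by case: ifP; lia.
- by rewrite /G (gtn_eqF hi) csum_nn.
exists C => [|b bn]; last by rewrite HC ?(ltnW hi) // /G eqxx.
by apply/agree_off_rowP => a b an bn ai; rewrite HC // /G (negPf ai).
Qed.

(** A discrete intermediate value argument: the difference of the two rows is 0
    at [b = 0], is 2 at [b = n], and changes by at most 1. *)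
Lemma middle_gap A : exists2 b, (b <= n)%N & csum A i.+2 b = csum A i b + 1.
Proof.
have exG : exists b, csum A i b < csum A i.+2 b.
  by exists n; rewrite !csum_wide ?(ltnW (ltn_ord i)) //; lia.
case: (ex_minnP exG) => -[|b] lt_b minb; first by rewrite !csum0r in lt_b.
have gap : csum A i.+2 b.+1 = csum A i b.+1 + 1.
  have := minb b; rewrite ltnn.
  have := asm_stepH A i b; have := asm_stepH A i.+2 b; lia.
exists b.+1 => //; apply: minb.
by rewrite !csum_wide ?(ltnW (ltn_ord i)) //; lia.
Qed.

(** [pi_i] is constant on fibres, hence idempotent; conversely [A] is the image
    of the maximum of its fibre, which is not [A] since it has a liftable
    position. *)
Lemma asm_pi_imageP A :
  asm_pi i A = A <-> exists C : asm n, C <> A /\ asm_pi i C = A.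
Proof.
split=> [fixA|[C [_ CA]]]; last first.
  rewrite -{2}CA; apply: asm_pi_agree; apply: agree_off_row_sym; rewrite -CA.
  by have [] := asm_piP C.
have [C fibC Crow] := lowest_corner_row A.
exists C; split; last by rewrite -(asm_pi_agree fibC).
move=> CA; have [b bn gap] := middle_gap A.
have /asm_pi_fixP/(_ b) := fixA; rewrite /liftable -CA Crow // CA gap.
lia.
Qed.

Lemma asm_pi_descentP A : asm_pi i A = A <-> ~ descent i A.
Proof.
split=> [fixA [_ /(_ fixA)] //|nd]; case: (asm_pi i A =P A) => // neq; case: nd.
by split=> //; have [_ /(_ A)] := asm_piP A; apply.
Qed.

End Fibres.

(** * Essential cells *)

(** An essential cell is a corner of the middle row: being an inversion means
    [y = x] there and a constant step of [y] just before.  The cell below can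
    then fail to be an inversion only by its row sum, which is liftability: if
    its column sum were 1 and its row sum 0, then [z] would be below [y] one
    column before.  At a lift corner, the increase of [y] just after is what
    makes the cell to the right fail to be an inversion. *)
Lemma essential_cellP (n : nat) (A : asm n) (i : 'I_n) : (i.+1 < n)%N ->
  (forall b, ~~ liftable A i b) <-> (forall j, ~~ essential_cell A i j).
Proof.
move=> hi.
have rowE (a j : 'I_n) : row_psum A a j = csum A a.+1 j.+1 - csum A a j.+1.
  by rewrite csumSl addrC addKr.
have colE (a j : 'I_n) : col_psum A a j = csum A a.+1 j.+1 - csum A a.+1 j.
  by rewrite csumSr addrC addKr.
split=> L.
  move=> j; apply/negP=> /and3P[/andP[/eqP R0 /eqP C0] /forallP down _].
  have := down (Ordinal hi); rewrite eqxx /= /inversion rowE colE /=.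
  rewrite rowE in R0; rewrite colE in C0; have := L j.+1; rewrite /liftable.
  have := asm_stepV A i.+1 j; have := asm_stepV A i.+1 j.+1.
  have := asm_stepH A i.+2 j.
  lia.
move=> b; apply/negP=> /(liftable_corner hi)[p [pn]].
move=> /andP[/eqP Ex /eqP Ez] El Er.
have /negP[] := L (Ordinal (ltnW pn)); apply/and3P; split.
- by rewrite /inversion rowE colE /=; lia.
- apply/forallP=> i'; apply/implyP=> /eqP Ei.
  by rewrite /inversion rowE Ei /=; lia.
apply/forallP=> j'; apply/implyP=> /eqP Ej.
by rewrite /inversion colE Ej /=; lia.
Qed.

(** * Monotone triangles *)

Lemma ltn_nth_sorted (s : seq nat) d j k : sorted ltn s -> (j < size s)%N ->
  (nth d s j < k)%N = (j < count (fun x => (x < k)%N) s)%N.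
Proof.
rewrite ltn_sorted_uniq_leq => /andP[_ s_le] js; have [jk|kj] := ltnP j.
  exact: (@nth_count_lt _ nat).
rewrite ltnNge; apply/negbF.
by apply: (@nth_count_ge _ nat); rewrite ?kj.
Qed.

Lemma row_sumsE (n : nat) (A : 'M[int]_n) (r c : 'I_n) :
  row_sums A r c = psum (A^~ c) r.+1.
Proof. by rewrite mxE summxE; apply: eq_bigr => k _; rewrite mxE. Qed.

(** Entry [j] of row [r] is the column of the one number [j], counted from 0,
    of row [r] of the row sums; it lies in the first [k] columns iff these
    contain more than [j] ones, and their number is a corner sum.  This Galois
    connection reduces all questions on the triangle to the step conditions on
    corner sums. *)
Lemma triangle_lt (n : nat) (A : asm n) (r : 'I_n) (j : 'I_r.+1) k :
  (k <= n)%N -> (triangle_of A j < k)%N = (j%:Z < csum A r.+1 k).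
Proof.
move=> kn; rewrite /triangle_of; set s := filter _ _.
have countE l : csum A r.+1 l = (count (fun x => (x < l)%N) (map val s))%:Z.
  rewrite count_map count_filter -sum1_count big_enum_cond /= csumC /psum.
  rewrite -natz natr_sum [RHS]big_mkcondr /=; apply: eq_bigr => c _.
  rewrite row_sumsE -/(psum (A^~ c) r.+1); have := asm_col01 A c r.+1.
  by case: eqP => [->//|ne1]; lia.
have sizeE : size (map val s) = r.+1.
  apply/eqP; rewrite -eqz_nat -(csum_wide A (ltn_ord r) (leqnn n)) countE.
  rewrite eqz_nat -count_predT; apply/eqP/eq_in_count => x /mapP[c _ ->].
  by rewrite ltn_ord.
rewrite -(nth_map r 0%N val) -?(size_map val) ?sizeE //.
rewrite ltn_nth_sorted ?sizeE ?countE //.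
rewrite sorted_map; apply: sorted_filter.
  by move=> x y z; apply: ltn_trans.
by rewrite -sorted_map val_enum_ord iota_ltn_sorted.
Qed.

Lemma row_containsP (n : nat) (A : asm n) (r k : 'I_n) :
  row_contains (triangle_of A) r k <->
  csum A r.+1 k.+1 = csum A r.+1 k + 1.
Proof.
have kn := ltn_ord k; split=> [[j jk]|E].
  have := triangle_lt A j kn; have := triangle_lt A j (ltnW kn).
  rewrite jk ltnn ltnSn; have := asm_stepH A r.+1 k; lia.
have jr : (`|csum A r.+1 k| < r.+1)%N.
  have := csum_le A r.+1 k.+1; have := csum_ge0 A r.+1 k; lia.
exists (Ordinal jr); apply: val_inj => /=.
have := triangle_lt A (Ordinal jr) kn.
have := triangle_lt A (Ordinal jr) (ltnW kn).
rewrite E /=; have := csum_ge0 A r.+1 k; lia.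
Qed.

Lemma triangle_of_monotone (n : nat) (A : asm n) : is_monotone (triangle_of A).
Proof.
split.
- move=> r j j' jj'; rewrite triangle_lt; last exact: ltnW.
  have := triangle_lt A j' (ltn_ord (triangle_of A j')); rewrite ltnSn.
  have := asm_stepH A r.+1 (triangle_of A j'); lia.
- move=> r r' j j' rr' jj'; rewrite -ltnS triangle_lt //.
  set k := (triangle_of A j' : nat); have kn : (k < n)%N by apply: ltn_ord.
  have rk : csum A r.+1 k.+1 = csum A r'.+2 k.+1 by rewrite rr'.
  have := triangle_lt A j' kn; rewrite ltnSn.
  have := asm_stepV A r'.+1 k.+1; lia.
move=> r r' j j' rr' jj'; rewrite -ltnS triangle_lt //.
set k := (triangle_of A j' : nat); have kn : (k < n)%N by apply: ltn_ord.
have rk : csum A r'.+1 k.+1 = csum A r.+2 k.+1 by rewrite rr'.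
have := triangle_lt A j' kn; rewrite ltnSn.
have := asm_stepV A r.+1 k.+1; lia.
Qed.

(** If the entry at [b] can be decreased from [p] to [p - 1], then [y p = b],
    the upper row has at least [b] ones before [p] and the lower one at least
    [b + 1]: so [p] is liftable.  Conversely, at a corner the decreased triangle
    is the triangle of the raised matrix, and so it is monotone. *)
Lemma essential_pointP (n : nat) (A : asm n) (i : 'I_n) : (i.+1 < n)%N ->
  (forall b, ~~ liftable A i b) <->
  (forall b : 'I_i.+1, ~ essential_point (triangle_of A) b).
Proof.
move=> hi; split=> [L b [m' [m'b m'off [_ mV mD]]]|L b].
  set p := triangle_of A b in m'b.
  have pn := ltn_ord p.
  have y1 := triangle_lt A b pn; have y0 := triangle_lt A b (ltnW pn).
  rewrite -/p ltnSn in y1; rewrite -/p ltnn in y0.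
  have x0 : b%:Z <= csum A i p.
    have [->|b0] := posnP b; first exact: csum_ge0.
    have i0 : (0 < i)%N by have := ltn_ord b; lia.
    have in' : (i.-1 < n)%N by have := ltn_ord i; lia.
    have bi : (b.-1 < i.-1.+1)%N by have := ltn_ord b; lia.
    have := mD (Ordinal in') i (Ordinal bi) b
              (esym (prednK i0)) (esym (prednK b0)).
    rewrite m'off ?xpair_eqE /=; last by lia.
    rewrite -ltnS m'b triangle_lt ?(ltnW pn) //= (prednK i0); lia.
  have bi : (b < i.+2)%N by apply: ltnW (ltn_ord b).
  have := mV (Ordinal hi) i (Ordinal bi) b erefl erefl.
  rewrite m'off ?xpair_eqE /=; last by lia.
  rewrite -ltnS m'b triangle_lt ?(ltnW pn) //= => z1.
  have := L p; rewrite /liftable.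
  have := asm_stepH A i.+1 p; have := asm_stepV A i p.
  have := asm_stepV A i.+1 p.
  lia.
apply/negP=> /(liftable_corner hi)[p cp]; have [B HB] := raise_corner hi cp.
have [pn _ El Er] := cp.
(* The one in column [p.+1] has [csum A i.+1 p] ones before it in its row. *)
have bi : (`|csum A i.+1 p| < i.+1)%N.
  have := csum_le A i.+1 p.+2; have := csum_ge0 A i.+1 p; lia.
have bE : `|csum A i.+1 p|%N%:Z = csum A i.+1 p.
  by have := csum_ge0 A i.+1 p; lia.
apply: (L (Ordinal bi)); exists (triangle_of B); split.
- have mA : triangle_of A (Ordinal bi) = p.+1 :> nat.
    have := triangle_lt A (Ordinal bi) pn.
    have := triangle_lt A (Ordinal bi) (ltnW pn); rewrite /= bE; lia.
  rewrite mA; congr _.+1.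
  have := triangle_lt B (Ordinal bi) (ltnW pn).
  have := triangle_lt B (Ordinal bi) (ltnW (ltnW pn)).
  rewrite !HB ?(ltnW pn) ?(ltnW (ltnW pn)) ?(ltn_ord i) //= !eqxx /= bE.
  rewrite (ltn_eqF (ltnSn p)) /=; lia.
- move=> r j rj; apply: val_inj.
  have same k : (k <= n)%N -> (triangle_of B j < k)%N = (triangle_of A j < k)%N.
    move=> kn; rewrite !triangle_lt // HB // eqSS.
    case: (r =P i :> nat) => [ri|_]; last by rewrite addr0.
    case: (k =P p.+1) => [->|_]; last by rewrite addr0.
    have rE : csum A r.+1 p.+1 = csum A i.+1 p by rewrite ri El.
    by move: rj; rewrite rE xpair_eqE (introT eqP ri) /= -eqz_nat bE; lia.
  have := same _ (ltn_ord (triangle_of A j)).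
  have := same _ (ltn_ord (triangle_of B j)); rewrite !ltnSn /=; lia.
exact: triangle_of_monotone.
Qed.

(** * Bumpless pipe dreams *)

Lemma mem_zip_r (S T : eqType) (s : seq S) (t : seq T) x y :
  (x, y) \in zip s t -> y \in t.
Proof.
elim: s t => [|u s IH] [|v t] //=; rewrite !inE => /orP[/eqP[_ ->]|/IH ->].
  by rewrite eqxx.
exact: orbT.
Qed.

(** A pipe enters the right edge of a cell through a segment of the tile, never
    by starting there; and every segment lies on one of the pipes. *)
Lemma passes_columnP (n : nat) (D : bpd n) (r j : 'I_n) :
  passes_column D r j <-> meets_right (D r j).
Proof.
split=> [[[|e p] // /and3P[bot_e e_path _]]|/seg_right[e seg]].
  rewrite inE => /orP[/eqP E|]; first by rewrite -E in bot_e.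
  elim: p e e_path {bot_e} => //= f p IH e /andP[ef f_path].
  rewrite inE => /orP[/eqP E|]; last exact: IH f_path.
  by apply/seg_right; exists e; rewrite [mid _ _ _]E.
have [P [/allP pipes cnt]] := bpdP D.
have /hasP[p pP used] : has (uses_segment e (mid r j Right)) P.
  by rewrite has_count (cnt _ _ seg).
exists p; first exact: pipes.
exact/mem_behead/(mem_zip_r used).
Qed.

Lemma Phi_meets_right (n : nat) (A : asm n) (r j : 'I_n) :
  csum A r.+1 j.+1 = csum A r j.+1 + (meets_right (Phi A r j))%:Z.
Proof.
rewrite csumSl; congr (_ + _).
have E : bpd_to_asm (Phi A) = A by rewrite /Phi; case: bpd_to_asm_onto.
rewrite -(bpd_row_psum r j (bpd_local (bpdP (Phi A)))).
by rewrite -[bpd_mx _]/(bpd_to_asm (Phi A) : 'M_n) E.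
Qed.

Lemma liftable_crossingP (n : nat) (A : asm n) (i : 'I_n) : (i.+1 < n)%N ->
  (forall b, ~~ liftable A i b) <-> ~ liftable_column_crossing (Phi A) i.
Proof.
move=> hi; have crossE (i' j : 'I_n) : i' = i.+1 :> nat ->
    liftable A i j.+1 = meets_right (Phi A i' j) && ~~ meets_right (Phi A i j).
  move=> Ei; rewrite /liftable -Ei !Phi_meets_right Ei Phi_meets_right.
  by case: meets_right; case: meets_right => /=; lia.
split=> [L [i' [j [Ei _ /passes_columnP c1 c0]]]|L b].
  have := L j.+1; rewrite (crossE _ _ Ei) c1 /= negbK => ci.
  by apply: c0; apply/passes_columnP.
apply/negP=> Lb; have := liftable_bounds hi Lb.
case: b Lb => // j Lj /andP[_ jn].
have := crossE (Ordinal hi) (Ordinal (ltnW jn)) erefl.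
rewrite Lj => /esym/andP[c1 c0].
apply: L; exists (Ordinal hi), (Ordinal (ltnW jn)); split=> //.
  exact/passes_columnP.
by move/passes_columnP; apply/negP.
Qed.

(** Row [r] of [m_{A^T}] contains [k] iff row [k] of [A] has partial sum 1 after
    its first [r.+1] columns. *)
Lemma transpose_rowsP (n : nat) (A : asm n) (i : 'I_n) (hi : (i.+1 < n)%N) :
  (forall b, ~~ liftable A i b) <->
  (forall r : 'I_n, row_contains (triangle_of A^T) r (Ordinal hi) ->
                    row_contains (triangle_of A^T) r i).
Proof.
have rowP r k : row_contains (triangle_of A^T) r k <->
    csum A k.+1 r.+1 = csum A k r.+1 + 1.
  by have := row_containsP (asm_tr A) r k; rewrite /= !csum_tr.
split=> [L r /rowP /= y1|L b].
  apply/rowP; have := L r.+1; rewrite /liftable y1 eqxx andbT.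
  have := asm_stepV A i r.+1; lia.
apply/negP=> Lb; have := liftable_bounds hi Lb; case: b Lb => // r.
move=> /andP[/eqP y0 /eqP y1] /andP[_ rn].
have /rowP := L _ (proj2 (rowP (Ordinal (ltnW rn)) (Ordinal hi)) y1).
by rewrite /= y0; lia.
Qed.

Theorem proposition4p19 (n : nat) (A : asm n) (i : 'I_n) (hi : (i.+1 < n)%N) :
  [<-> forall r : 'I_n, row_contains (triangle_of A^T) r (Ordinal hi) ->
                        row_contains (triangle_of A^T) r i;
       asm_pi i A = A;
       forall j : 'I_n, ~~ essential_cell A i j;
       forall b : 'I_i.+1, ~ essential_point (triangle_of A) b;
       exists C : asm n, C <> A /\ asm_pi i C = A;
       ~ liftable_column_crossing (Phi A) i]
  /\ (asm_pi i A = A <-> ~ descent i A).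
Proof.
split; last exact: asm_pi_descentP.
have rows := transpose_rowsP A hi; have fix_pi := asm_pi_fixP hi A.
have cells := essential_cellP A hi; have points := essential_pointP A hi.
have image := asm_pi_imageP hi A; have crossings := liftable_crossingP A hi.
by tfae; tauto.
Qed.
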